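(* There is a polynomial $\ell$ of degree $3$ in one variable such that the following holds. Let $n\ge 1$ and $m\ge 1$ be integers, let $p$ be a prime number, and let $f_0=x, f_1,\ldots,f_{n-1}\in \mathbb{F}_p[x]\setminus \mathbb{F}_p(x-1)$ be pairwise different, monic, irreducible polynomials. Let $$A=\mathbb{F}_p\Big[x^{\pm 1},\tfrac{1}{f_1},\ldots,\tfrac{1}{f_{n-1}}\Big]\subseteq \mathbb{F}_p(x).$$ Then the group $PU(m,A)$ is transitive, finite-state and state-closed of degree $p^{\ell(m)}$; that is, it is isomorphic to a state-closed, finite-state subgroup of $\mathrm{Aut}(\mathcal{T}_{p^{\ell(m)}})$ which acts transitively on the first level of the tree $\mathcal{T}_{p^{\ell(m)}}$.
   Context: $U(m,A)$ is the group of invertible upper triangular $m\times m$ matrices over $A$ (Borel subgroup of $GL_m(A)$), and $PU(m,A)$ is its projective quotient, i.e. the quotient of $U(m,A)$ by its subgroup of scalar matrices $\lambda I_m$, $\lambda\in A^*$ (which is its center). $\mathbb{F}_p(x-1)$ denotes the set of $\mathbb{F}_p$-multiples of $x-1$. For an integer $k\ge 1$, $\mathcal{T}_k$ is the infinite regular one-rooted $k$-tree (every vertex has exactly $k$ descendants on the next level) and $\mathrm{Aut}(\mathcal{T}_k)$ is its group of level-preserving automorphisms. The first level is identified with $\{0,\ldots,k-1\}$, and every $g\in \mathrm{Aut}(\mathcal{T}_k)$ is written uniquely as $g=(g_0,\ldots,g_{k-1})\sigma$, where $\sigma$ is the permutation of the first level induced by $g$ and $g_i\in\mathrm{Aut}(\mathcal{T}_k)$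 is the induced action on the subtree headed by the vertex $i$ (this subtree being identified with $\mathcal{T}_k$). The set of states $\mathcal{Q}(g)$ is defined recursively by $\mathcal{Q}(g)=\{g\}\cup\bigcup_i \mathcal{Q}(g_i)$ (the smallest set containing $g$ and closed under $h\mapsto h_i$). A subgroup $G\le\mathrm{Aut}(\mathcal{T}_k)$ is state-closed if $g_i\in G$ for all $g\in G$ and all $i$; it is finite-state if $\mathcal{Q}(g)$ is finite for every $g\in G$. *)

(* Defs.v *)
From HB Require Import structures.
From mathcomp Require Import all_boot all_order all_algebra.
From mathcomp Require Import generic_quotient fraction.
From mathcomp Require Import boolp classical_sets functions cardinality.

Set Implicit Arguments.
Unset Strict Implicit.
Unset Printing Implicit Defensive.

Import GRing.Theory.

Local Open Scope classical_set_scope.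
Local Open Scope ring_scope.

Section Tree.
Variable k : nat.

(* The vertices of the k-tree are the words over {0, ..., k-1}: the root is
   the empty word, level l consists of the words of length l, and the
   descendants of v on the next level are the k words rcons v i. *)
Definition child (v w : seq 'I_k) : bool := [exists i, w == rcons v i].

Record treeAut := TreeAut {
  aut_fun :> seq 'I_k -> seq 'I_k;
  aut_bij : bijective aut_fun;
  aut_size : forall v, size (aut_fun v) = size v;
  aut_child : {mono aut_fun : v w / child v w} }.

HB.instance Definition _ := gen_eqMixin treeAut.
HB.instance Definition _ := gen_choiceMixin treeAut.

Lemma treeAutP (g h : treeAut) : g =1 h -> g = h.
Proof.
case: g h => [g g1 g2 g3] [h h1 h2 h3] /= /funext gh.
by case: _ / gh in h1 h2 h3 *; congr TreeAut; apply: Prop_irrelevance.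
Qed.

Definition aut_one : treeAut :=
  @TreeAut id (Bijective (fun=> erefl) (fun=> erefl))
    (fun=> erefl) (fun _ _ => erefl).

Section Mul.
Variables g h : treeAut.

Lemma aut_mul_bij : bijective (h \o g).
Proof. exact: bij_comp (aut_bij h) (aut_bij g). Qed.

Lemma aut_mul_size v : size ((h \o g) v) = size v.
Proof. by rewrite /= !aut_size. Qed.

Lemma aut_mul_child : {mono h \o g : v w / child v w}.
Proof. by move=> v w; rewrite /= !aut_child. Qed.

(* Automorphisms act on the right: g * h is g followed by h. *)
Definition aut_mul := TreeAut aut_mul_bij aut_mul_size aut_mul_child.
End Mul.

Section Inv.
Variable g : treeAut.

Lemma aut_inv_subproof :
  {f : seq 'I_k -> seq 'I_k | cancel g f & cancel f g}.
Proof.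
have /cid [f fP] : exists f, cancel g f /\ cancel f g.
  by have [f gf fg] := aut_bij g; exists f.
by exists f; case: fP.
Qed.

Definition aut_inv_fun := s2val aut_inv_subproof.

Lemma aut_funK : cancel g aut_inv_fun.
Proof. exact: s2valP aut_inv_subproof. Qed.

Lemma aut_inv_funK : cancel aut_inv_fun g.
Proof. exact: s2valP' aut_inv_subproof. Qed.

Lemma aut_inv_bij : bijective aut_inv_fun.
Proof. exact: Bijective aut_inv_funK aut_funK. Qed.

Lemma aut_inv_size v : size (aut_inv_fun v) = size v.
Proof. by rewrite -(aut_size g) aut_inv_funK. Qed.

Lemma aut_inv_child : {mono aut_inv_fun : v w / child v w}.
Proof. by move=> v w; rewrite -(aut_child g) !aut_inv_funK. Qed.

Definition aut_inv := TreeAut aut_inv_bij aut_inv_size aut_inv_child.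
End Inv.

Lemma aut_mulA : associative aut_mul.
Proof. by move=> f g h; apply: treeAutP. Qed.

Lemma aut_mul1 : left_id aut_one aut_mul.
Proof. by move=> g; apply: treeAutP. Qed.

Lemma aut_mulr1 : right_id aut_one aut_mul.
Proof. by move=> g; apply: treeAutP. Qed.

Lemma aut_mulV : left_inverse aut_one aut_inv aut_mul.
Proof. by move=> g; apply: treeAutP => v /=; rewrite aut_inv_funK. Qed.

Lemma aut_mulrV : right_inverse aut_one aut_inv aut_mul.
Proof. by move=> g; apply: treeAutP => v /=; rewrite aut_funK. Qed.

HB.instance Definition _ := isGroup.Build treeAut
  aut_mulA aut_mul1 aut_mulr1 aut_mulV aut_mulrV.

Section State.
Variables (g : treeAut) (i : 'I_k).

Lemma aut_rcons (h : treeAut) v j : exists j', h (rcons v j) = rcons (h v) j'.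
Proof.
have : child (h v) (h (rcons v j)).
  by rewrite aut_child; apply/existsP; exists j.
by case/existsP => j' /eqP ->; exists j'.
Qed.

Lemma aut_cons (h : treeAut) (a : 'I_k) w : exists s, h (a :: w) = h [:: a] ++ s.
Proof.
elim/last_ind: w => [|w b [s IH]]; first by exists [::]; rewrite cats0.
have [b' E] := aut_rcons h (a :: w) b.
by exists (rcons s b'); rewrite -rcons_cons E IH rcons_cat.
Qed.

Definition state_fun (w : seq 'I_k) : seq 'I_k := behead (g (i :: w)).

Lemma state_funE : exists2 j, g [:: i] = [:: j]
  & forall w, g (i :: w) = j :: state_fun w.
Proof.
have := aut_size g [:: i].
case E: (g [:: i]) => [|j [|]] // _; exists j => // w.
by have [s] := aut_cons g i w; rewrite /state_fun E => ->.
Qed.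

Lemma state_bij : bijective state_fun.
Proof.
have [j gi gE] := state_funE.
exists (fun v => behead (aut_inv g (j :: v))) => [w|v].
  by rewrite -gE [aut_inv g _]aut_funK.
have [s] := aut_cons (aut_inv g) j v.
have -> : aut_inv g [:: j] = [:: i] by rewrite -gi; apply: aut_funK.
rewrite cat1s => E; rewrite E /=.
have : g (aut_inv g (j :: v)) = j :: v by apply: aut_inv_funK.
by rewrite E gE => -[].
Qed.

Lemma state_size v : size (state_fun v) = size v.
Proof. by rewrite size_behead aut_size. Qed.

Lemma child_cons a v w : child (a :: v) (a :: w) = child v w.
Proof.
by apply: eq_existsb => b; rewrite rcons_cons eqseq_cons eqxx.
Qed.

Lemma state_child : {mono state_fun : v w / child v w}.
Proof.
have [j _ gE] := state_funE.
by move=> v w; rewrite -(child_cons j) -!gE aut_child child_cons.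
Qed.

(* The component g_i of g = (g_0, ..., g_{k-1}) sigma: g maps the vertex i w
   to the vertex sigma(i) (g_i w). *)
Definition state : treeAut := TreeAut state_bij state_size state_child.
End State.

Inductive states (g : treeAut) : set treeAut :=
| states_self : states g g
| states_state h i : states g h -> states g (state h i).

Definition state_closed (G : set treeAut) : Prop :=
  forall g i, G g -> G (state g i).

Definition finite_state (G : set treeAut) : Prop :=
  forall g, G g -> finite_set (states g).

Definition transitive_level1 (G : set treeAut) : Prop :=
  forall i j, exists2 g, G g & g [:: i] = [:: j].

End Tree.

Definition transitive_finite_state_state_closed (k : nat) (H : groupType) :=
  exists G : set (treeAut k),
    [/\ group_closed [in G],
        exists phi : {multiplicative H -> treeAut k}, set_bij [set: H] G phi,
        state_closed G, finite_state G & transitive_level1 G].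

Section Borel.
Variables (m : nat) (R : comUnitRingType).

(* is_trig_mx means lower triangular. *)
Definition borel_pred (M : 'M[R]_m) : bool := is_trig_mx M^T && (M \in unitmx).

Definition borel := {M : 'M[R]_m | borel_pred M}.

HB.instance Definition _ := Choice.on borel.

Lemma upperP (M : 'M[R]_m) :
  reflect (forall i j : 'I_m, (j < i)%N -> M i j = 0) (is_trig_mx M^T).
Proof.
apply: (iffP is_trig_mxP) => H i j ij; first by have := H j i ij; rewrite mxE.
by rewrite mxE H.
Qed.

Lemma borel_one_subproof : borel_pred 1%:M.
Proof.
rewrite /borel_pred unitmx1 andbT; apply/upperP => i j ji.
by rewrite mxE -val_eqE /= gtn_eqF.
Qed.

Lemma borel_mul_subproof (g h : borel) : borel_pred (val g *m val h).
Proof.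
case: g h => [M /andP[/upperP Mt Mu]] [N /andP[/upperP Nt Nu]] /=.
rewrite /borel_pred unitmx_mul Mu Nu !andbT; apply/upperP => i j ji.
rewrite mxE big1 // => l _.
have [li|il] := ltnP l i; first by rewrite Mt // mul0r.
by rewrite Nt ?mulr0 // (leq_trans ji).
Qed.

Lemma borel_inv_subproof (g : borel) : borel_pred (invmx (val g)).
Proof.
case: g => [M /andP[Mt Mu]] /=.
rewrite /borel_pred unitmx_inv Mu andbT; apply/upperP.
have Mii i : M i i \is a GRing.unit.
  have : \prod_i M i i \is a GRing.unit.
    move: Mu; rewrite unitmxE -det_tr det_trig //.
    by rewrite [in X in X -> _](eq_bigr (fun a => M a a)) // => a _; rewrite mxE.
  by rewrite (bigD1 i) //= unitrM => /andP[].
move/upperP: Mt => Mt i j.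
have [l] := ubnP (m - i)%N; elim: l i => // l IH i li ji.
have := congr1 (fun N : 'M_m => N i j) (mulmxV Mu).
rewrite !mxE -val_eqE /= gtn_eqF // mulr0n (bigD1 i) //= big1 ?addr0.
  by move/(congr1 (fun x => (M i i)^-1 * x)); rewrite mulr0 mulKr.
move=> a ai; have [lt_ai|le_ia] := ltnP a i; first by rewrite Mt // mul0r.
have lt_ia : (i < a)%N by rewrite ltn_neqAle le_ia andbT eq_sym val_eqE.
rewrite IH ?mulr0 //; last exact: ltn_trans lt_ia.
by rewrite (leq_trans _ (li : (m - i <= l)%N)) // ltn_sub2l.
Qed.

Definition borel_one : borel := Sub 1%:M borel_one_subproof.
Definition borel_mul (g h : borel) : borel := Sub _ (borel_mul_subproof g h).
Definition borel_inv (g : borel) : borel := Sub _ (borel_inv_subproof g).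

Lemma borel_unit (g : borel) : val g \in unitmx.
Proof. by case: g => M /= /andP[]. Qed.

Lemma borel_mulA : associative borel_mul.
Proof. by move=> f g h; apply: val_inj; rewrite /= mulmxA. Qed.

Lemma borel_mul1 : left_id borel_one borel_mul.
Proof. by move=> g; apply: val_inj; rewrite /= mul1mx. Qed.

Lemma borel_mulr1 : right_id borel_one borel_mul.
Proof. by move=> g; apply: val_inj; rewrite /= mulmx1. Qed.

Lemma borel_mulV : left_inverse borel_one borel_inv borel_mul.
Proof. by move=> g; apply: val_inj; rewrite /= mulVmx ?borel_unit. Qed.

Lemma borel_mulrV : right_inverse borel_one borel_inv borel_mul.
Proof. by move=> g; apply: val_inj; rewrite /= mulmxV ?borel_unit. Qed.

HB.instance Definition _ := isGroup.Build borel
  borel_mulA borel_mul1 borel_mulr1 borel_mulV borel_mulrV.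

Local Open Scope group_scope.

(* As g is invertible, the scalar is a unit of R. *)
Definition scalar_borel (g : borel) : bool := is_scalar_mx (val g).

Definition proj_rel (g h : borel) : bool := scalar_borel (g^-1 * h).

Lemma scalar_borel1 : scalar_borel 1.
Proof. exact: scalar_mx_is_scalar. Qed.

Lemma scalar_borelM g h :
  scalar_borel g -> scalar_borel h -> scalar_borel (g * h).
Proof.
move=> /is_scalar_mxP[a ga] /is_scalar_mxP[b hb]; apply/is_scalar_mxP.
by exists (a * b)%R; rewrite /= ga hb -scalar_mxM.
Qed.

Lemma scalar_borel_comm g h : scalar_borel g -> g * h = h * g.
Proof.
move=> /is_scalar_mxP[a ga]; apply: val_inj.
by rewrite /= ga scalar_mxC.
Qed.

Lemma scalar_borelV g : scalar_borel g -> scalar_borel g^-1.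
Proof.
move=> /is_scalar_mxP[a ga]; apply/is_scalar_mxP; exists a^-1%R.
by rewrite /= ga invmx_scalar.
Qed.

Lemma proj_rel_refl : reflexive proj_rel.
Proof. by move=> g; rewrite /proj_rel mulVg scalar_borel1. Qed.

Lemma proj_rel_sym : symmetric proj_rel.
Proof.
suff H g h : proj_rel g h -> proj_rel h g by move=> g h; apply/idP/idP; apply: H.
by move/scalar_borelV; rewrite invgM invgK.
Qed.

Lemma proj_rel_trans : transitive proj_rel.
Proof.
move=> h g f gh hf; have := scalar_borelM gh hf.
by rewrite mulgA mulgK.
Qed.

Canonical proj_equiv :=
  EquivRel proj_rel proj_rel_refl proj_rel_sym proj_rel_trans.

(* The group of left cosets of the central subgroup of scalar matrices. *)
Definition pborel := {eq_quot proj_equiv}%qT.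

HB.instance Definition _ := EqQuotient.on pborel.
HB.instance Definition _ := Choice.on pborel.

Local Open Scope quotient_scope.

Definition pborel_one : pborel := \pi_pborel 1.
Definition pborel_mul (x y : pborel) : pborel := \pi_pborel (repr x * repr y).
Definition pborel_inv (x : pborel) : pborel := \pi_pborel (repr x)^-1.

Lemma pi_proj (g h : borel) : proj_rel g h -> \pi_pborel g = \pi_pborel h.
Proof. by move=> gh; apply/eqmodP. Qed.

Lemma proj_repr (g : borel) : proj_rel g (repr (\pi_pborel g)).
Proof. by apply/eqmodP; rewrite reprK. Qed.

Lemma pborel_mulE (g h : borel) :
  pborel_mul (\pi_pborel g) (\pi_pborel h) = \pi_pborel (g * h).
Proof.
apply/esym/pi_proj.
set g' := repr _; set h' := repr _.
have gg' : proj_rel g g' := proj_repr g.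
have hh' : proj_rel h h' := proj_repr h.
rewrite /proj_rel invgM.
have -> : h^-1 * g^-1 * (g' * h') = h^-1 * ((g^-1 * g') * h').
  by rewrite !mulgA.
rewrite (scalar_borel_comm _ gg') mulgA.
exact: scalar_borelM.
Qed.

Lemma pborel_invE (g : borel) :
  pborel_inv (\pi_pborel g) = \pi_pborel g^-1.
Proof.
apply/esym/pi_proj.
set g' := repr _.
have gg' : proj_rel g g' := proj_repr g.
rewrite /proj_rel invgK.
have sgg : scalar_borel (g'^-1 * g).
  by have := scalar_borelV gg'; rewrite invgM invgK.
have -> : g * g'^-1 = g'^-1 * g; last exact: sgg.
have E : g'^-1 * g * g' = g by rewrite scalar_borel_comm // mulgA mulgV mul1g.
by rewrite -[in LHS]E -mulgA mulgV mulg1.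
Qed.

Lemma pborel_mulA : associative pborel_mul.
Proof.
move=> x y z; elim/quotW: x => f; elim/quotW: y => g; elim/quotW: z => h.
rewrite (pborel_mulE g h) (pborel_mulE f g) (pborel_mulE f (g * h)).
by rewrite (pborel_mulE (f * g) h) mulgA.
Qed.

Lemma pborel_mul1 : left_id pborel_one pborel_mul.
Proof. by move=> x; elim/quotW: x => g; rewrite (pborel_mulE 1 g) mul1g. Qed.

Lemma pborel_mulr1 : right_id pborel_one pborel_mul.
Proof. by move=> x; elim/quotW: x => g; rewrite (pborel_mulE g 1) mulg1. Qed.

Lemma pborel_mulV : left_inverse pborel_one pborel_inv pborel_mul.
Proof.
move=> x; elim/quotW: x => g.
by rewrite (pborel_invE g) (pborel_mulE g^-1 g) mulVg.
Qed.

Lemma pborel_mulrV : right_inverse pborel_one pborel_inv pborel_mul.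
Proof.
move=> x; elim/quotW: x => g.
by rewrite (pborel_invE g) (pborel_mulE g g^-1) mulgV.
Qed.

HB.instance Definition _ := isGroup.Build pborel
  pborel_mulA pborel_mul1 pborel_mulr1 pborel_mulV pborel_mulrV.

End Borel.

Section GeneratedSubring.
Variables (K : fieldType) (S : set K).

Definition gen_subring_pred : {pred K} :=
  [in smallest (fun B : set K => subring_closed [in B]) S].

Lemma gen_subringP z : reflect
  (forall B : set K, subring_closed [in B] -> S `<=` B -> B z)
  (z \in gen_subring_pred).
Proof.
apply: (iffP idP) => [/set_mem H B Br SB|H]; first exact: (H B).
by apply: mem_set => B [Br SB]; apply: H.
Qed.

Lemma gen_subring_closed : subring_closed gen_subring_pred.
Proof.
split=> [|x y /gen_subringP Sx /gen_subringP Sy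
         |x y /gen_subringP Sx /gen_subringP Sy]; apply/gen_subringP => B Br SB;
  have [B1 BB BM] := Br; apply: set_mem => //.
- by apply: BB; apply: mem_set; [apply: Sx|apply: Sy].
- by apply: BM; apply: mem_set; [apply: Sx|apply: Sy].
Qed.

HB.instance Definition _ :=
  GRing.isSubringClosed.Build K gen_subring_pred gen_subring_closed.

Definition gen_subring := {z : K | z \in gen_subring_pred}.

HB.instance Definition _ := SubChoice.on gen_subring.
HB.instance Definition _ :=
  [SubChoice_isSubComNzRing of gen_subring by <:].

Definition gen_subring_unit : {pred gen_subring} :=
  fun z => (val z != 0) && ((val z)^-1 \in gen_subring_pred).

Definition gen_subring_inv (z : gen_subring) : gen_subring :=
  insubd z (val z)^-1.

Lemma gen_subring_mulVr :
  {in gen_subring_unit, left_inverse 1 gen_subring_inv *%R}.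
Proof.
move=> z /andP[z0 zV]; apply: val_inj; rewrite rmorphM rmorph1 /=.
by rewrite /gen_subring_inv insubdK // mulVf.
Qed.

Lemma gen_subring_unitP (x y : gen_subring) :
  y * x = 1 -> x \in gen_subring_unit.
Proof.
move/(congr1 val); rewrite rmorphM rmorph1 /= => yx.
have x0 : val x != 0.
  by apply: contra_eq_neq yx => ->; rewrite mulr0 eq_sym oner_neq0.
apply/andP; split=> //.
suff -> : (val x)^-1 = val y by exact: valP.
by apply: (mulIf x0); rewrite mulVf.
Qed.

Lemma gen_subring_inv_out : {in [predC gen_subring_unit], gen_subring_inv =1 id}.
Proof.
move=> z; rewrite inE /= negb_and negbK => /orP[/eqP z0|zV].
  apply: val_inj; rewrite /gen_subring_inv val_insubd z0 invr0.
  by case: ifP.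
by apply: val_inj; rewrite /gen_subring_inv val_insubd (negPf zV).
Qed.

HB.instance Definition _ := GRing.ComNzRing_hasMulInverse.Build gen_subring
  gen_subring_mulVr gen_subring_unitP gen_subring_inv_out.

End GeneratedSubring.

Local Notation "x %:F" := (@FracField.tofrac _ x).

(* The ring F_p[x, 1/x, 1/f_1, ..., 1/f_{n-1}]; the index 0 of f is skipped. *)
Definition laurent_ring (p n : nat) (f : 'I_n -> {poly 'F_p}) :
    comUnitRingType :=
  gen_subring
    ([set c%:P%:F | c in [set: 'F_p]] `|`
     [set 'X%:F; ('X%:F)^-1] `|`
     [set ((f i)%:F)^-1 | i in [set i : 'I_n | (0 < i)%N]]
     : set {fraction {poly 'F_p}}).

(* Main.v *)
From HB Require Import structures.
Require Import Defs.
From mathcomp Require Import all_boot all_order all_algebra.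
From mathcomp Require Import generic_quotient fraction.
From mathcomp Require Import boolp classical_sets cardinality.
From mathcomp Require Import ring zify.

Set Implicit Arguments.
Unset Strict Implicit.
Unset Printing Implicit Defensive.

Import GRing.Theory.

Local Open Scope classical_set_scope.

(** Write A for the ring, y = x - 1 and U for the invertible upper triangular
    matrices over A. Being irreducible and no multiple of x - 1, the f_i do not
    vanish at 1 (irreducible_not_root1), so evaluation at 1 maps A onto
    F_p = A / yA. Let delta be the diagonal matrix with entries y^i. Conjugation
    by delta divides the entry (i, j) by y^(j - i), hence is a virtual
    endomorphism of U (and of PU, since it fixes scalars): it is defined on the
    subgroup H of the matrices whose (i, j) entry is divisible by y^(j - i).
    The index of H is p^d, where d is the sum of the gaps j - i over i < j,
    that is (m^3 - m) / 6; a transversal is given by the unitriangular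
    matrices whose (i, j) entry is a polynomial in y over F_p of degree less
    than j - i (digit_transversal_ex, digit_transversal_uniq). A virtual
    endomorphism and a transversal of its domain always give an action on the
    tree of words in the transversal, which permutes the first level
    transitively and has state-closed image (virtual_endomorphism_action).

    The action is faithful (dilation_core). The off-diagonal entries of an
    element of the kernel can be divided by y for ever, so they vanish, and a
    diagonal matrix which remains diagonal after conjugation by the
    transversal is scalar.

    The action is finite-state (dilation_filtration). Fix a common denominator
    q of the entries of g and a bound N on the degrees of their numerators.
    Multiplying g on either side by elements of the transversal or their
    inverses keeps q and raises the degree of the entry (i, j) by at most
    j - i; conjugation by delta then lowers it by exactly j - i. Thus all
    states of g have entries with denominator q and numerators of degree at
    most N, and there are finitely many of these over F_p. *)

(** * Self-similar actions on a regular tree *)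

Section SelfSimilarAction.
Local Open Scope group_scope.
Variables (T : finType) (G : groupType).
Variables (act : G -> T -> T) (res : G -> T -> G).
Hypothesis act1 : forall x, act 1 x = x.
Hypothesis res1 : forall x, res 1 x = 1.
Hypothesis actM : forall g h x, act (g * h) x = act h (act g x).
Hypothesis resM : forall g h x, res (g * h) x = res g x * res h (act g x).

Fixpoint word_act (g : G) (w : seq 'I_#|T|) : seq 'I_#|T| :=
  if w is i :: w' then
    enum_rank (act g (enum_val i)) :: word_act (res g (enum_val i)) w'
  else [::].

Lemma word_act1 w : word_act 1 w = w.
Proof. by elim: w => //= i w IH; rewrite act1 res1 enum_valK IH. Qed.

Lemma word_actM g h w : word_act (g * h) w = word_act h (word_act g w).
Proof.
elim: w g h => //= i w IH g h.
by rewrite enum_rankK actM resM IH.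
Qed.

Lemma word_act_bij g : bijective (word_act g).
Proof.
by exists (word_act g^-1) => w; rewrite -word_actM ?mulgV ?mulVg word_act1.
Qed.

Lemma size_word_act g w : size (word_act g w) = size w.
Proof. by elim: w g => //= i w IH g; rewrite IH. Qed.

Lemma child_word_act g : {mono word_act g : v w / child v w}.
Proof.
have sub h v w : child v w -> child (word_act h v) (word_act h w).
  case/existsP => i /eqP ->; apply/existsP.
  elim: v h => [|j v IH] h /=; first by eexists.
  by have [i' /eqP ->] := IH (res h (enum_val j)); exists i'.
move=> v w; apply/idP/idP; last exact: sub.
by move/(sub g^-1); rewrite -!word_actM mulgV !word_act1.
Qed.

Definition tree_act (g : G) : treeAut #|T| :=
  TreeAut (word_act_bij g) (size_word_act g) (child_word_act g).

Lemma tree_actM g h : tree_act (g * h) = tree_act g * tree_act h.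
Proof. by apply: treeAutP => w; rewrite /= word_actM. Qed.

HB.instance Definition _ := isMultiplicative.Build G (treeAut #|T|) tree_act
  tree_actM.

Lemma tree_act_one : tree_act 1 = 1.
Proof. by apply: treeAutP => w; rewrite /= word_act1. Qed.

Lemma tree_actV g : tree_act g^-1 = (tree_act g)^-1.
Proof.
by apply: (mulgI (tree_act g)); rewrite -tree_actM !mulgV tree_act_one.
Qed.

Lemma state_tree_act g i : state (tree_act g) i = tree_act (res g (enum_val i)).
Proof. exact: treeAutP. Qed.

(** Faithfulness may be tested on sets K of elements which fix all letters and
    restrict to K, because the kernel of the action on the tree is such a
    set. The states of the image of g are the images of the elements reached
    from g by restriction, so a set Q stable under restriction bounds them. *)
Lemma self_similar_action :
  (forall K : set G,
     (forall g x, K g -> act g x = x /\ K (res g x)) ->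
   forall g, K g -> g = 1) ->
  (forall g, exists Q : set G,
     [/\ finite_set Q, Q g & forall h x, Q h -> Q (res h x)]) ->
  (forall x y, exists g, act g x = y) ->
  transitive_finite_state_state_closed #|T| G.
Proof.
move=> faithful finite trans; exists (range tree_act); split.
- split=> [|_ _ /set_mem[g _ <-] /set_mem[h _ <-]]; apply: mem_set.
    by exists 1 => //; rewrite tree_act_one.
  by exists (g / h) => //; rewrite tree_actM tree_actV.
- exists tree_act; split=> [g _|g h _ _ gh|] //.
  suff : g / h = 1 by apply: divg1_eq.
  apply: (faithful [set u | forall w, word_act u w = w]) => [u x uK|w].
    have E w : word_act u (enum_rank x :: w) = enum_rank x :: w by apply: uK.
    split; first by have /= := E [::]; rewrite enum_rankK => -[] /enum_rank_inj.
    by move=> w; have /= := E w; rewrite enum_rankK => -[].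
  have := congr1 (fun a : treeAut _ => aut_fun a w) (tree_actM g h^-1).
  by rewrite tree_actV gh mulgV.
- by move=> _ i [g _ <-]; rewrite state_tree_act; exists (res g (enum_val i)).
- move=> _ [g _ <-]; have [Q [Qfin Qg Qres]] := finite g.
  apply: (sub_finite_set _ (finite_image tree_act Qfin)).
  move=> v; elim=> [|u i _ [h Qh <-]]; first by exists g.
  by rewrite state_tree_act; exists (res h (enum_val i)); first exact: Qres.
move=> i j; have [g gij] := trans (enum_val i) (enum_val j).
by exists (tree_act g); [exists g | rewrite /= gij enum_valK].
Qed.

End SelfSimilarAction.

(** * Virtual endomorphisms with a transversal *)

Section VirtualEndomorphism.
Local Open Scope group_scope.
(** The virtual endomorphism is given by its graph phi, so that its domain need
    not be made into a group. *)
Variables (T : finType) (G : groupType) (phi : G -> G -> Prop) (t : T -> G).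
Hypothesis phi1 : phi 1 1.
Hypothesis phiM : forall g g' r r', phi g r -> phi g' r' ->
  phi (g * g') (r * r').
Hypothesis phi_fun : forall g r r', phi g r -> phi g r' -> r = r'.
Hypothesis t_ex : forall g, exists x r, phi (g * t x) r.
Hypothesis t_inj : forall g x x' r r',
  phi (g * t x) r -> phi (g * t x') r' -> x = x'.

(** With H the domain of phi, right multiplication by g moves the coset
    H (t x)^-1 to H (t y)^-1, and r is the value of phi on the cocycle
    (t x)^-1 g (t y) of this move. *)
Definition transition g x y r := phi ((t x)^-1 * g * t y) r.

Lemma transition_ex g x : {yr : T * G | transition g x yr.1 yr.2}.
Proof. by apply: cid; have [y [r H]] := t_ex ((t x)^-1 * g); exists (y, r). Qed.

Let act g x := (sval (transition_ex g x)).1.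
Let res g x := (sval (transition_ex g x)).2.

Lemma transition_act_res g x : transition g x (act g x) (res g x).
Proof. exact: svalP (transition_ex g x). Qed.

Lemma transition_uniq g x y r :
  transition g x y r -> act g x = y /\ res g x = r.
Proof.
move=> H; have E := t_inj (transition_act_res g x) H; split=> //.
by apply: phi_fun H; rewrite -E; apply: transition_act_res.
Qed.

Lemma transition1 x : transition 1 x x 1.
Proof. by rewrite /transition mulg1 mulVg. Qed.

Lemma transitionM g h x y z r s :
  transition g x y r -> transition h y z s -> transition (g * h) x z (r * s).
Proof.
by move=> gr hs; have := phiM gr hs; rewrite /transition !mulgA mulgK.
Qed.

(** The letters are the cosets of the domain, on which G is transitive:
    (t x) (t y)^-1 moves x to y with trivial cocycle. *)
Lemma virtual_endomorphism_action :
  (forall K : set G,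
     (forall g x, K g -> exists2 r, K r & transition g x x r) ->
   forall g, K g -> g = 1) ->
  (forall g, exists Q : set G,
     [/\ finite_set Q, Q g
       & forall h x y r, Q h -> transition h x y r -> Q r]) ->
  transitive_finite_state_state_closed #|T| G.
Proof.
move=> faithful finite; apply: (@self_similar_action _ _ act res).
- by move=> x; have [] := transition_uniq (transition1 x).
- by move=> x; have [] := transition_uniq (transition1 x).
- move=> g h x; have [] // := transition_uniq
    (transitionM (transition_act_res g x) (transition_act_res h (act g x))).
- move=> g h x; have [] // := transition_uniq
    (transitionM (transition_act_res g x) (transition_act_res h (act g x))).
- move=> K HK; apply: faithful => g x Kg; have [gx Kr] := HK g x Kg.
  by exists (res g x) => //; rewrite -{2}gx; apply: transition_act_res.
- move=> g; have [Q [Qfin Qg Qres]] := finite g; exists Q; split=> // h x Qh.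
  exact: Qres (transition_act_res h x).
move=> x y; exists (t x * (t y)^-1).
suff /transition_uniq[] : transition (t x * (t y)^-1) x y 1 by [].
by rewrite /transition mulKg mulVg.
Qed.

End VirtualEndomorphism.

Local Open Scope ring_scope.

(** * Upper triangular matrices *)

Section UpperTriangularDeterminant.
Variables (R : comUnitRingType) (m : nat).

Lemma det_upper (M : 'M[R]_m) : is_trig_mx M^T -> \det M = \prod_i M i i.
Proof.
by move=> Mt; rewrite -det_tr det_trig //; apply: eq_bigr => i _; rewrite mxE.
Qed.

Lemma borel_upper (g : borel m R) (i j : 'I_m) : (j < i)%N -> val g i j = 0.
Proof. by case: g => M /= /andP[/upperP Mt _]; apply: Mt. Qed.

Lemma borel_diag_unit (g : borel m R) i : val g i i \is a GRing.unit.
Proof.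
case: g => M /= /andP[Mt]; rewrite unitmxE det_upper // (bigD1 i) //= unitrM.
by case/andP.
Qed.

Lemma borel_pred_diag (M : 'M[R]_m) :
  is_trig_mx M^T -> (forall i, M i i \is a GRing.unit) -> borel_pred M.
Proof.
by move=> Mt Mu; rewrite /borel_pred Mt unitmxE det_upper ?rpred_prod.
Qed.

Lemma borel_mulE (g h : borel m R) i j :
  val (g * h)%g i j = \sum_k val g i k * val h k j.
Proof. by rewrite mxE. Qed.

End UpperTriangularDeterminant.

Lemma finite_matrix_set (R : zmodType) (m : nat) (W : set R) :
  finite_set W -> finite_set [set M : 'M[R]_m | forall i j, W (M i j)].
Proof.
move=> /finite_seqP[s ->].
pose entries (f : {ffun 'I_m * 'I_m -> 'I_(size s)}) : 'M[R]_m :=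
  \matrix_(i, j) nth 0 s (f (i, j)).
apply: (sub_finite_set _ (finite_image entries (@finite_finset _ setT))).
move=> M Ms; have lt_s ij : (index (M ij.1 ij.2) s < size s)%N.
  by rewrite index_mem; apply: Ms.
exists [ffun ij => Ordinal (lt_s ij)] => //.
by apply/matrixP => i j; rewrite mxE ffunE /= nth_index //; apply: Ms.
Qed.

(** * Digit expansions and degree filtrations *)

Section Dilation.
Variables (F : finFieldType) (A : comUnitRingType) (kappa : {rmorphism F -> A}).
Variable y : A.
(** The ideal yA has residue field F, split by kappa: this is what expansions in
    powers of y with digits in F require. *)
Hypothesis y_lreg : GRing.lreg y.
Hypothesis residue_ex : forall a, exists c b, a = kappa c + y * b.
Hypothesis residue_uniq : forall c b, kappa c = y * b -> c = 0.

Definition digits l (c : {ffun 'I_l -> F}) : A :=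
  \sum_(k < l) kappa (c k) * y ^+ k.

Lemma digits_empty l (c : {ffun 'I_l -> F}) : l = 0%N -> digits c = 0.
Proof. by move=> l0; move: c; rewrite l0 => c; rewrite /digits big_ord0. Qed.

Lemma digits_one l :
  (0 < l)%N -> digits [ffun k : 'I_l => (k == 0%N :> nat)%:R] = 1.
Proof.
case: l => // l _; rewrite /digits big_ord_recl ffunE rmorph1 mulr1.
rewrite big1 ?addr0 //.
by move=> k _; rewrite ffunE rmorph0 mul0r.
Qed.

Lemma digits_ex l a :
  exists (c : {ffun 'I_l -> F}) b, a = digits c + y ^+ l * b.
Proof.
elim: l => [|l [c [b ->]]].
  by exists [ffun=> 0], a; rewrite digits_empty // add0r mul1r.
have [e [b' ->]] := residue_ex b.
exists [ffun k => oapp c e (unlift ord_max k)], b'.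
rewrite /digits big_ord_recr /= ffunE unlift_none /= exprSr mulrDr mulrA addrA.
congr (_ + _ + _); last by rewrite mulrC.
apply: eq_bigr => k _; have -> : widen_ord (leqnSn l) k = lift ord_max k.
  by apply: val_inj; rewrite /= /bump leqNgt ltn_ord.
by rewrite ffunE liftK.
Qed.

Lemma digits_eq0 l (c : {ffun 'I_l -> F}) b : digits c = y ^+ l * b -> c = 0.
Proof.
elim: l c b => [|l IH] c b; first by move=> _; apply/ffunP => -[].
pose c' := [ffun k => c (lift ord0 k)].
have -> : digits c = kappa (c ord0) + y * digits c'.
  rewrite /digits big_ord_recl mulr1; congr (_ + _); rewrite mulr_sumr.
  by apply: eq_bigr => k _; rewrite ffunE mulrCA -exprS.
move=> E; have c0 : c ord0 = 0.
  apply: (@residue_uniq _ (y ^+ l * b - digits c')).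
  by rewrite mulrBr mulrA -exprS -E addrK.
move: E; rewrite c0 rmorph0 add0r exprS -mulrA => /y_lreg/IH c'0.
apply/ffunP => k; rewrite ffunE; have [j ->|->//] := unliftP ord0 k.
by have := congr1 (fun f : {ffun _} => f j) c'0; rewrite !ffunE.
Qed.

Lemma digits_inj l (c c' : {ffun 'I_l -> F}) b :
  digits c - digits c' = y ^+ l * b -> c = c'.
Proof.
move=> E; apply/subr0_eq/(@digits_eq0 _ _ b); rewrite -E /digits -sumrB.
by apply: eq_bigr => k _; rewrite !ffunE rmorphB mulrBl.
Qed.

(** The model is the set W n of the fractions over a fixed denominator q whose
    numerator is a polynomial in y of degree less than n. As a has no pole at
    y = 0, the numerator of y * a is divisible by y, whence filt_div. *)
Record degree_filtration (W : nat -> set A) : Prop := DegreeFiltration {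
  filt_finite : forall n, finite_set (W n);
  filt_bot : forall a, W 0%N a -> a = 0;
  filt0 : forall n, W n 0;
  filtB : forall n a b, W n a -> W n b -> W n (a - b);
  filt_scale : forall n c a, W n a -> W n (kappa c * a);
  filt_up : forall n a, W n a -> W n.+1 a;
  filt_mul : forall n a, W n a -> W n.+1 (y * a);
  filt_div : forall n a, W n.+1 (y * a) -> W n a }.

Section FiltrationTheory.
Variables (W : nat -> set A) (WP : degree_filtration W).

Lemma filtD n a b : W n a -> W n b -> W n (a + b).
Proof.
move=> Wa Wb; rewrite -[b]opprK -[- b]sub0r.
by apply: (filtB WP) => //; apply: (filtB WP) => //; apply: (filt0 WP).
Qed.

Lemma filt_sum n I (s : seq I) (P : pred I) (f : I -> A) :
  (forall i, P i -> W n (f i)) -> W n (\sum_(i <- s | P i) f i).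
Proof.
by move=> Wf; elim/big_ind: _ => //; [apply: (filt0 WP) | apply: filtD].
Qed.

Lemma filt_le n l a : (n <= l)%N -> W n a -> W l a.
Proof.
by move=> /subnK <-; elim: (l - n)%N => // d IH /IH /(filt_up WP); rewrite addSn.
Qed.

Lemma filt_mulX n l a : W n a -> W (n + l) (y ^+ l * a).
Proof.
move=> Wa; elim: l => [|l IH]; first by rewrite addn0 mul1r.
by rewrite addnS exprS -mulrA; apply: (filt_mul WP).
Qed.

Lemma filt_divX n l a : W (n + l) (y ^+ l * a) -> W n a.
Proof.
elim: l => [|l IH]; first by rewrite addn0 mul1r.
by rewrite addnS exprS -mulrA => /(filt_div WP).
Qed.

Lemma filt_digits n l (c : {ffun 'I_l -> F}) a :
  W n a -> W (n + l) (digits c * a).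
Proof.
move=> Wa; rewrite /digits mulr_suml; apply: filt_sum => k _.
rewrite -mulrA; apply: (filt_scale WP); apply: filt_le (filt_mulX k Wa).
by rewrite leq_add2l ltnW.
Qed.

End FiltrationTheory.

Hypothesis filtration_ex : forall s : seq A, exists W n,
  degree_filtration W /\ {in s, forall a, W n a}.

(** Dividing by y^n an element of W n leaves an element of W 0, which is
    trivial. *)
Lemma y_separated a : (forall n, exists b, a = y ^+ n * b) -> a = 0.
Proof.
move=> ydvd; have [W [n [WP /(_ a)]]] := filtration_ex [:: a].
rewrite mem_head => /(_ isT) Wa; have [b ab] := ydvd n.
suff /(filt_bot WP) b0 : W 0%N b by rewrite ab b0 mulr0.
by apply: (filt_divX WP (l := n)); rewrite -ab.
Qed.

(** * The dilation of the Borel group and its transversal *)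

Section ProjectiveBorel.
Variable m : nat.

Implicit Types g h r : borel m A.

(** This says that r is the conjugate of h by the diagonal matrix with entries
    y^i; multiplying out avoids the inverse of y, which is not in A. *)
Definition dilation h r : Prop :=
  forall i j : 'I_m, y ^+ i * val h i j = val r i j * y ^+ j.

Lemma dilation_scalar h : scalar_borel h -> dilation h h.
Proof.
case/is_scalar_mxP => a ha i j.
have -> : val h i j = a *+ (i == j) by rewrite ha mxE.
case: eqP => [->|_]; last by rewrite mulr0n mulr0 mul0r.
exact: mulrC.
Qed.

Lemma dilationM h h' r r' :
  dilation h r -> dilation h' r' -> dilation (h * h')%g (r * r')%g.
Proof.
move=> hr hr' i j; rewrite !borel_mulE mulr_sumr mulr_suml.
by apply: eq_bigr => k _; rewrite mulrA hr -!mulrA hr'.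
Qed.

Lemma dilation_fun h r r' : dilation h r -> dilation h r' -> r = r'.
Proof.
move=> hr hr'; apply/val_inj/matrixP => i j; apply: (@GRing.lregX _ _ j y_lreg).
by rewrite mulrC -hr hr' mulrC.
Qed.

Lemma dilation_dvd h r (i j : 'I_m) :
  dilation h r -> (i <= j)%N -> val h i j = y ^+ (j - i) * val r i j.
Proof.
move=> hr ij; apply: (@GRing.lregX _ _ i y_lreg).
by rewrite hr mulrA -exprD subnKC // mulrC.
Qed.

Lemma dilation_ex h :
  (forall i j : 'I_m, exists b, val h i j = y ^+ (j - i) * b) ->
  exists r, dilation h r.
Proof.
move=> H; pose b i j := sval (cid (H i j)).
have bP i j : val h i j = y ^+ (j - i) * b i j := svalP (cid (H i j)).
have M_borel : borel_pred (\matrix_(i, j) if (i <= j)%N then b i j else 0).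
  apply: borel_pred_diag => [|i].
    by apply/upperP => i j; rewrite mxE ltnNge; case: leq.
  by rewrite mxE leqnn; have := borel_diag_unit h i; rewrite bP subnn mul1r.
exists (Sub _ M_borel) => i j; rewrite SubK mxE; case: leqP => [ij|ji].
  by rewrite bP mulrA -exprD subnKC // mulrC.
by rewrite borel_upper // mulr0 mul0r.
Qed.

(** The gap ij.2 - ij.1 is a truncated difference: there are no digits on or
    below the diagonal. *)
Definition digit_array : finType :=
  {dffun forall ij : 'I_m * 'I_m, {ffun 'I_(ij.2 - ij.1) -> F}}.

Definition digit_mx (x : digit_array) : 'M[A]_m :=
  \matrix_(i, j) ((i == j)%:R + digits (x (i, j))).

Lemma digit_mx_upper x (i j : 'I_m) :
  (j <= i)%N -> digit_mx x i j = (i == j)%:R.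
Proof.
move=> ji; rewrite mxE digits_empty ?addr0 //=.
by apply/eqP; rewrite subn_eq0.
Qed.

Lemma digit_mx_borel x : borel_pred (digit_mx x).
Proof.
apply: borel_pred_diag => [|i]; last by rewrite digit_mx_upper // eqxx unitr1.
by apply/upperP => i j ji; rewrite digit_mx_upper 1?ltnW // -val_eqE /= gtn_eqF.
Qed.

Definition digit_borel x : borel m A := Sub _ (digit_mx_borel x).

Lemma digit_borelE x i j :
  val (digit_borel x) i j = (i == j)%:R + digits (x (i, j)).
Proof. by rewrite mxE. Qed.

(** A representative u of the coset of h^-1 is sought with the entry (i, j) of
    h u divisible by y^(j - i). Column j of h u depends on column j of u only,
    and row i of h involves the entries of that column in rows k >= i only, so
    they are found from the bottom row up: as h i i is a unit, the entry in
    row i is determined modulo y^(j - i). The bottom l rows are done here. *)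
Lemma digit_column_ex h (j : 'I_m) l :
  exists v : 'I_m -> A,
    (forall i : 'I_m, exists c : {ffun 'I_(j - i) -> F}, v i = digits c) /\
    forall i : 'I_m, (m <= i + l)%N ->
      exists b, \sum_k val h i k * ((k == j)%:R + v k) = y ^+ (j - i) * b.
Proof.
elim: l => [|l [v [vd vE]]].
  exists (fun=> 0); split=> i; last by rewrite addn0 leqNgt ltn_ord.
  exists 0; rewrite /digits big1 // => k _.
  by rewrite ffunE rmorph0 mul0r.
have [le_ml|lt_lm] := leqP m l.
  by exists v; split=> // i _; apply: vE; apply: leq_trans (leq_addl _ _).
have i0P : (m - l.+1 < m)%N by lia.
(* i0 is the next row to treat, and e what the other entries contribute. *)
pose i0 := Ordinal i0P.
pose e := \sum_(k | k != i0) val h i0 k * ((k == j)%:R + v k).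
have [c [b cE]] := digits_ex (j - i0)
  (- ((val h i0 i0)^-1 * e + (i0 == j)%:R)).
exists (fun k => if k == i0 then digits c else v k); split=> [i|i le_mi].
  by have [->|_] := eqVneq i i0; [exists c | apply: vd].
have [->|i_i0] := eqVneq i i0.
  exists (- val h i0 i0 * b); rewrite (bigD1 i0) //= eqxx.
  have -> : \sum_(k | k != i0) val h i0 k *
      ((k == j)%:R + (if k == i0 then digits c else v k)) = e.
    by apply: eq_bigr => k /negPf ->.
  have -> : digits c = - ((val h i0 i0)^-1 * e + (i0 == j)%:R)
      - y ^+ (j - i0) * b by rewrite cE addrK.
  have /divrr u := borel_diag_unit h i0.
  rewrite !mulrDr !mulrN mulrDr mulrA u; ring.
have lt_i0i : (i0 < i)%N by move: i_i0 le_mi; rewrite -val_eqE /=; lia.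
have le_mi' : (m <= i + l)%N by move: lt_i0i => /=; lia.
have [b' b'E] := vE i le_mi'; exists b'; rewrite -b'E.
apply: eq_bigr => k _; have [->|//] := eqVneq k i0.
by rewrite borel_upper // !mul0r.
Qed.

Lemma digit_transversal_ex h : exists x r, dilation (h * digit_borel x)%g r.
Proof.
pose v j := sval (cid (digit_column_ex h j m)).
have [vd vE] : (forall j i : 'I_m, exists c : {ffun 'I_(j - i) -> F},
      v j i = digits c) /\
    forall j i : 'I_m, exists b,
      \sum_k val h i k * ((k == j)%:R + v j k) = y ^+ (j - i) * b.
  split=> j i; first exact: (svalP (cid (digit_column_ex h j m))).1.
  by apply: (svalP (cid (digit_column_ex h j m))).2; apply: leq_addl.
exists (finfun (fun ij => sval (cid (vd ij.2 ij.1)))).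
apply: dilation_ex => i j; have [b bE] := vE j i; exists b.
rewrite -bE borel_mulE; apply: eq_bigr => k _.
by rewrite digit_borelE ffunE -(svalP (cid (vd j k))).
Qed.

(** The same triangular system as for existence: in column j, once the entries
    below row i agree, the two entries in row i are congruent modulo
    y^(j - i), and such an entry has only j - i digits. *)
Lemma digit_transversal_uniq h x x' r r' :
  dilation (h * digit_borel x)%g r -> dilation (h * digit_borel x')%g r' ->
  x = x'.
Proof.
move=> xr xr'; apply/ffunP => -[i j].
have [l] := ubnP (m - i)%N; elim: l i => // l IH i li.
have [le_ji|lt_ij] := leqP j i.
  by apply/ffunP => -[k lt_k]; exfalso; move: lt_k le_ji => /=; lia.
apply: (@digits_inj _ _ _ ((val h i i)^-1 * (val r i j - val r' i j))).
apply: (mulrI (borel_diag_unit h i)).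
rewrite [RHS]mulrCA mulVKr ?borel_diag_unit // [RHS]mulrBr /=.
rewrite -(dilation_dvd xr) -?(dilation_dvd xr') ?(ltnW lt_ij) //.
rewrite !borel_mulE -[RHS]sumrB.
rewrite [RHS](bigD1 i) //= big1 ?addr0 => [|k k_i].
  by rewrite !digit_borelE -mulrBr opprD addrACA subrr add0r.
have [lt_ki|le_ik] := ltnP k i; first by rewrite borel_upper // !mul0r subrr.
have lt_ik : (i < k)%N by rewrite ltn_neqAle le_ik andbT eq_sym val_eqE.
by rewrite !digit_borelE IH ?subrr //; have := ltn_ord k; lia.
Qed.

Local Notation U := digit_borel.

(** Multiplying by the digit matrices raises the degree of the entry (i, j) by
    at most j - i, and the dilation lowers it by j - i. The inverse of U x on
    the left is dealt with by solving U x * N = g * U x' for N from the bottom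
    row up. *)
Lemma dilation_filtration W n g r x x' :
  degree_filtration W -> (forall i j, W n (val g i j)) ->
  dilation ((U x)^-1 * g * U x')%g r -> forall i j, W n (val r i j).
Proof.
move=> WP Wg; set N := (_ * _ * _)%g => Nr.
have NE : (U x * N = g * U x')%g by rewrite /N -mulgA mulVKg.
have WgU (i j : 'I_m) : W (n + (j - i))%N (val (g * U x')%g i j).
  rewrite borel_mulE; apply: (filt_sum WP) => k _.
  have [lt_ki|le_ik] := ltnP k i.
    by rewrite borel_upper // mul0r; apply: (filt0 WP).
  rewrite digit_borelE mulrC mulrDl; apply: (filtD WP).
    case: eqP => _; rewrite ?mul1r ?mul0r; last exact: (filt0 WP).
    by apply: (filt_le WP) (Wg i k); apply: leq_addr.
  apply: (filt_le WP) (filt_digits WP (x' (k, j)) (Wg i k)).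
  by rewrite leq_add2l leq_sub2l.
have WN (i j : 'I_m) : W (n + (j - i))%N (val N i j).
  have [l] := ubnP (m - i)%N; elim: l i => // l IH i li.
  have := WgU i j; rewrite -NE borel_mulE.
  have -> : \sum_k val (U x) i k * val N k j =
      val N i j + \sum_k digits (x (i, k)) * val N k j.
    under eq_bigr do rewrite digit_borelE mulrDl.
    rewrite big_split /=; congr (_ + _).
    rewrite (bigD1 i) //= eqxx mul1r big1 ?addr0 // => k.
    by rewrite eq_sym => /negPf ->; rewrite mul0r.
  move=> Wsum.
  rewrite -[val N i j](addrK (\sum_k digits (x (i, k)) * val N k j)).
  apply: (filtB WP) Wsum _; apply: (filt_sum WP) => k _.
  have [le_ki|lt_ik] := leqP k i.
    rewrite digits_empty ?mul0r; first exact: (filt0 WP).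
    by apply/eqP; rewrite subn_eq0.
  have [lt_jk|le_kj] := ltnP j k.
    by rewrite borel_upper // mulr0; apply: (filt0 WP).
  have Wk : W (n + (j - k))%N (val N k j).
    by apply: IH; have := ltn_ord k; lia.
  by apply: (filt_le WP) (filt_digits WP (x (i, k)) Wk) => /=; lia.
move=> i j; have [lt_ji|le_ij] := ltnP j i.
  by rewrite borel_upper //; apply: (filt0 WP).
apply: (filt_divX WP (l := (j - i)%N)).
by rewrite -(dilation_dvd Nr).
Qed.

(** Triviality modulo scalars of the core of the dilation. Taking all digits
    zero, so that U x = 1, shows that K is stable under the dilation: its
    off-diagonal entries are divisible by every power of y, hence zero.
    Taking x = x1, for which the entries of U x above the diagonal are 1,
    the diagonal matrices g and r satisfy g * U x = U x * r, so that all their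
    diagonal entries coincide. *)
Lemma dilation_core (K : set (borel m A)) :
  (forall g x, K g -> exists2 r, K r & dilation ((U x)^-1 * g * U x)%g r) ->
  forall g, K g -> scalar_borel g.
Proof.
move=> HK.
have Kdiag g (i j : 'I_m) : K g -> i != j -> val g i j = 0.
  move=> Kg; rewrite -val_eqE neq_ltn /=.
  case/orP=> [lt_ij|]; last exact: borel_upper.
  apply: y_separated => n; elim: n g Kg => [|n IH] g Kg.
    by exists (val g i j); rewrite mul1r.
  have [r Kr] := HK g (finfun (fun=> 0)) Kg.
  have -> : U (finfun (fun=> 0)) = 1%g.
    apply/val_inj/matrixP => a b; rewrite digit_borelE ffunE /= mxE.
    rewrite /digits big1 ?addr0 // => k _.
    by rewrite ffunE rmorph0 mul0r.
  rewrite invg1 mul1g mulg1 => gr; have [b rb] := IH r Kr.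
  exists (y ^+ (j - i).-1 * b).
  rewrite (dilation_dvd gr (ltnW lt_ij)) rb !mulrA -!exprD.
  by congr (y ^+ _ * _); lia.
pose x1 : digit_array :=
  finfun (fun ij : 'I_m * 'I_m =>
    [ffun k : 'I_(ij.2 - ij.1) => (k == 0%N :> nat)%:R]).
have U1 (i j : 'I_m) : (i < j)%N -> val (U x1) i j = 1.
  move=> lt_ij; rewrite digit_borelE -val_eqE ltn_eqF //= add0r ffunE.
  by rewrite digits_one // subn_gt0.
move=> g Kg; have [r Kr] := HK g x1 Kg; set N := (_ * _ * _)%g => Nr.
have NE : (U x1 * N = g * U x1)%g by rewrite /N -mulgA mulVKg.
have N_diag (j : 'I_m) : val N j j = val r j j.
  by rewrite (dilation_dvd Nr) // subnn mul1r.
have N_off (i j : 'I_m) : i != j -> val N i j = 0.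
  move=> ij; have [lt_ji|le_ij] := ltnP j i; first exact: borel_upper.
  by rewrite (dilation_dvd Nr) // Kdiag // mulr0.
have comm (i j : 'I_m) :
    val (U x1) i j * val r j j = val g i i * val (U x1) i j.
  have := congr1 (fun h : borel m A => val h i j) NE; rewrite !borel_mulE.
  rewrite (bigD1 j) //= big1 ?addr0 => [|k kj]; last by rewrite N_off ?mulr0.
  rewrite N_diag (bigD1 i) //= big1 ?addr0 // => k ki.
  by rewrite Kdiag ?mul0r // eq_sym.
have rg (j : 'I_m) : val r j j = val g j j.
  have := comm j j; rewrite digit_borelE eqxx digits_empty ?subnn //.
  by rewrite addr0 mul1r mulr1.
have gg (i j : 'I_m) : val g i i = val g j j.
  wlog lt_ij : i j / (i < j)%N => [H|].
    by case: (ltngtP i j) => [/H|/H|/val_inj ->].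
  by have := comm i j; rewrite U1 // mul1r mulr1 rg.
apply/is_scalar_mxP.
case: (posnP m) => [m0|m_gt0].
  by exists 0; apply/matrixP => i; have := ltn_ord i; rewrite {2}m0.
exists (val g (Ordinal m_gt0) (Ordinal m_gt0)); apply/matrixP => i j.
rewrite mxE; have [->|ij] := eqVneq i j; first exact: gg.
exact: Kdiag.
Qed.

(** * Passage to the projective quotient *)

Definition proj_class g : pborel m A := \pi_(pborel m A)%qT g.

Lemma proj_classM g h : proj_class (g * h)%g = (proj_class g * proj_class h)%g.
Proof. exact/esym/pborel_mulE. Qed.

Lemma proj_classV g : proj_class g^-1%g = ((proj_class g)^-1)%g.
Proof. exact/esym/pborel_invE. Qed.

Lemma proj_class_surj (c : pborel m A) : exists g, proj_class g = c.
Proof. by elim/quotW: c => g; exists g. Qed.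

Lemma proj_class_eq g h : proj_class g = proj_class h ->
  exists2 z, scalar_borel z & h = (g * z)%g.
Proof.
move/eqmodP => gh; exists (g^-1 * h)%g; first exact: gh.
by rewrite mulVKg.
Qed.

Lemma proj_class_scalar z : scalar_borel z -> proj_class z = 1%g.
Proof.
move=> zP; apply/esym/pi_proj; rewrite /proj_rel.
by apply: scalar_borelM zP; apply: scalar_borelV; apply: scalar_borel1.
Qed.

(** The dilation fixes scalar matrices, so its image in the quotient is again
    the graph of a virtual endomorphism; any lift of c can be used to compute
    it (proj_dilationP). *)
Definition proj_dilation (c d : pborel m A) :=
  exists h r, [/\ proj_class h = c, proj_class r = d & dilation h r].

Lemma proj_dilationP h d : proj_dilation (proj_class h) d ->
  exists2 r, proj_class r = d & dilation h r.
Proof.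
case=> h' [r [/proj_class_eq[z zP ->] rd h'r]]; exists (r * z)%g.
  by rewrite proj_classM (proj_class_scalar zP) mulg1.
exact: dilationM h'r (dilation_scalar zP).
Qed.

Lemma transitionP g x x' d :
  transition proj_dilation (proj_class \o U) (proj_class g) x x' d ->
  exists2 r, proj_class r = d & dilation ((U x)^-1 * g * U x')%g r.
Proof.
move=> gd; apply: proj_dilationP.
by rewrite !proj_classM proj_classV.
Qed.

Lemma pborel_self_similar :
  transitive_finite_state_state_closed #|digit_array| (pborel m A).
Proof.
apply: (@virtual_endomorphism_action _ _ proj_dilation (proj_class \o U)).
- by exists 1%g, 1%g; split=> //; apply/dilation_scalar/scalar_borel1.
- move=> _ _ _ _ [g [r [<- <- gr]]] [g' [r' [<- <- gr']]].
  exists (g * g')%g, (r * r')%g; rewrite !proj_classM.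
  by split=> //; apply: dilationM.
- move=> c d d'; have [h <-] := proj_class_surj c.
  move=> /proj_dilationP[r <- hr] /proj_dilationP[r' <- hr'].
  by rewrite (dilation_fun hr hr').
- move=> c; have [h <-] := proj_class_surj c.
  have [x [r hr]] := digit_transversal_ex h.
  by exists x, (proj_class r), (h * U x)%g, r; rewrite proj_classM.
- move=> c x x' d d'; have [h <-] := proj_class_surj c.
  rewrite /= -!proj_classM => /proj_dilationP[r _ hr] /proj_dilationP[r' _ hr'].
  exact: (digit_transversal_uniq hr hr').
- move=> K HK c Kc; have [g gc] := proj_class_surj c.
  rewrite -gc; apply: proj_class_scalar.
  apply: (@dilation_core [set h | K (proj_class h)]); last by rewrite /= gc.
  move=> h x Kh; have [d Kd /transitionP[r rd hr]] := HK _ x Kh.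
  by exists r; rewrite //= rd.
move=> c; have [g <-] := proj_class_surj c.
have [W [n [WP Wg]]] :=
  filtration_ex [seq val g i j | i <- enum 'I_m, j <- enum 'I_m].
pose Q : set (borel m A) := [set h : borel m A | forall i j, W n (val h i j)].
exists (proj_class @` Q); split.
- apply: finite_image; apply: (finite_preimage (f := val)
    (B := [set M : 'M[A]_m | forall i j, W n (M i j)])).
    by move=> h h' _ _ /val_inj.
  exact: finite_matrix_set (filt_finite WP n).
- by exists g => // i j; apply/Wg/allpairs_f; rewrite mem_enum.
move=> _ x x' d [h Qh <-] /transitionP[r <- hr].
by exists r => //; apply: dilation_filtration WP Qh hr.
Qed.

End ProjectiveBorel.
End Dilation.

(** * Localisations of the polynomial ring away from 1 *)

Section LocalisedPolynomialRing.
Variables (F : finFieldType).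
Local Notation K := {fraction {poly F}}.
Local Notation "q %:F" := (@FracField.tofrac _ q).
Variable S : set K.
(** The ring generated by S lies between F[x] and its localisation at the
    maximal ideal of the point 1. *)
Hypothesis S_const : forall c : F, S (c%:P)%:F.
Hypothesis S_X : S 'X%:F.
Hypothesis S_local : forall z, S z ->
  (exists q, z = q%:F) \/ (exists2 q : {poly F}, q.[1] != 0 & z = (q%:F)^-1).

Local Notation A := (gen_subring S).

Lemma gen_subring_ind (P : A -> Prop) :
  P 1 -> (forall a b, P a -> P b -> P (a - b)) ->
  (forall a b, P a -> P b -> P (a * b)) ->
  (forall a, S (val a) -> P a) -> forall a, P a.
Proof.
move=> P1 PB PM PS a.
have /gen_subringP /(_ [set z | exists2 b : A, val b = z & P b]) H := valP a.
suff [b /val_inj <-] : exists2 b : A, val b = val a & P b by [].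
apply: H => [|z Sz].
  split=> [|_ _ /set_mem[b <- Pb] /set_mem[c <- Pc]
    |_ _ /set_mem[b <- Pb] /set_mem[c <- Pc]]; apply: mem_set.
  - by exists 1; rewrite ?rmorph1.
  - by exists (b - c); rewrite ?rmorphB //; apply: PB.
  - by exists (b * c); rewrite ?rmorphM //; apply: PM.
have zP : z \in gen_subring_pred S by apply/gen_subringP => B _; apply.
by exists (Sub z zP); rewrite ?SubK //; apply: PS; rewrite SubK.
Qed.

Lemma poly_mem (q : {poly F}) : q%:F \in gen_subring_pred S.
Proof.
have mem_S z : S z -> z \in gen_subring_pred S.
  by move=> Sz; apply/gen_subringP => B _; apply.
elim/poly_ind: q => [|q c IH]; first by rewrite rmorph0 rpred0.
rewrite rmorphD rmorphM; apply: rpredD; last exact/mem_S/S_const.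
exact: rpredM IH (mem_S _ S_X).
Qed.

Definition poly_in (q : {poly F}) : A := Sub q%:F (poly_mem q).

Lemma val_poly_in q : val (poly_in q) = q%:F. Proof. exact: SubK. Qed.

Lemma poly_in_zmod : zmod_morphism poly_in.
Proof. by move=> p q; apply: val_inj; rewrite rmorphB /= rmorphB. Qed.

Lemma poly_in_monoid : GRing.monoid_morphism poly_in.
Proof.
split; first by apply: val_inj; rewrite rmorph1 val_poly_in rmorph1.
by move=> p q; apply: val_inj; rewrite rmorphM /= rmorphM.
Qed.

HB.instance Definition _ := GRing.isZmodMorphism.Build {poly F} A poly_in
  poly_in_zmod.
HB.instance Definition _ := GRing.isMonoidMorphism.Build {poly F} A poly_in
  poly_in_monoid.

Lemma poly_in_inj : injective poly_in.
Proof.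
move=> p q /(congr1 val); rewrite !val_poly_in => /eqP.
by rewrite tofrac_eq => /eqP.
Qed.

Lemma poly_in_lreg q : q != 0 -> GRing.lreg (poly_in q).
Proof.
move=> q0 a b /(congr1 val); rewrite !rmorphM /= => E.
by apply: val_inj; apply: mulfI E; rewrite tofrac_eq0.
Qed.

Lemma gen_subring_local a :
  S (val a) -> (exists q, a = poly_in q) \/
               (exists2 q : {poly F}, q.[1] != 0 & a * poly_in q = 1).
Proof.
case/S_local => [[q aq]|[q q1 aq]]; [left; exists q|right; exists q => //];
  apply: val_inj; rewrite ?rmorph1 ?rmorphM /= aq //.
by rewrite mulVf // tofrac_eq0; apply: contraNneq q1 => ->; rewrite horner0.
Qed.

Lemma denominator_ex a : exists q r : {poly F},
  q.[1] != 0 /\ a * poly_in q = poly_in r.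
Proof.
elim/gen_subring_ind: a => [|a b [q [r [q1 aq]]] [q' [r' [q1' bq]]]
    |a b [q [r [q1 aq]]] [q' [r' [q1' bq]]]
    |a /gen_subring_local[[q ->]|[q q1 aq]]].
- by exists 1, 1; rewrite hornerC oner_neq0 mul1r.
- exists (q * q'), (r * q' - r' * q); rewrite hornerM mulf_neq0 //; split=> //.
  by rewrite rmorphB !rmorphM /= -aq -bq; ring.
- exists (q * q'), (r * r'); rewrite hornerM mulf_neq0 //; split=> //.
  by rewrite !rmorphM /= -aq -bq; ring.
- by exists 1, q; rewrite hornerC oner_neq0 rmorph1 mulr1.
by exists q, 1; rewrite q1 aq rmorph1.
Qed.

Lemma common_denominator_ex (s : seq A) : exists2 q : {poly F}, q != 0 &
  forall a, a \in s -> exists r, a * poly_in q = poly_in r.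
Proof.
elim: s => [|a s [q q0 IH]]; first by exists 1; rewrite ?oner_neq0.
have [q' [r [q1' aq']]] := denominator_ex a; exists (q' * q).
  by rewrite mulf_neq0 //; apply: contraNneq q1' => ->; rewrite horner0.
move=> b; rewrite in_cons => /predU1P[->|/IH[r' br']]; last first.
  by exists (q' * r'); rewrite !rmorphM /= mulrCA br'.
by exists (r * q); rewrite !rmorphM /= mulrA aq'.
Qed.

Let kappa : {rmorphism F -> A} := poly_in \o polyC.
Let y := poly_in ('X - 1%:P).

Lemma y_lreg : GRing.lreg y.
Proof. by apply: poly_in_lreg; rewrite polyXsubC_eq0. Qed.

Lemma poly_residue (q : {poly F}) :
  exists g, poly_in q = kappa q.[1] + y * poly_in g.
Proof.
have /factor_theorem[g gE] : root (q - q.[1]%:P) 1.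
  by rewrite rootE !hornerE subrr.
by exists g; rewrite /kappa /y /= -rmorphM mulrC -gE -rmorphD addrC subrK.
Qed.

(** Evaluation at 1 extends to the generators 1 / q, whose residue is 1 / q(1):
    with q = q(1) + y g one has 1 / q = 1 / q(1) - y g / (q(1) q). *)
Lemma residue_ex a : exists c b, a = kappa c + y * b.
Proof.
elim/gen_subring_ind: a => [|a a' [c [b ->]] [c' [b' ->]]
    |a a' [c [b ->]] [c' [b' ->]]|a /gen_subring_local[[q ->]|[q q1 aq]]].
- by exists 1, 0; rewrite rmorph1 mulr0 addr0.
- by exists (c - c'), (b - b'); rewrite rmorphB; ring.
- exists (c * c'), (b * kappa c' + kappa c * b' + y * b * b').
  by rewrite rmorphM; ring.
- by have [g ->] := poly_residue q; exists q.[1], (poly_in g).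
have [g qE] := poly_residue q.
exists q.[1]^-1, (- kappa q.[1]^-1 * poly_in g * a).
have u : kappa q.[1]^-1 * kappa q.[1] = 1 by rewrite -rmorphM mulVf // rmorph1.
rewrite -[LHS]mul1r -u -[X in _ = X + _]mulr1 -aq qE; ring.
Qed.

(** If b = r / q with q(1) <> 0, then c q = (x - 1) r as polynomials, and
    evaluation at 1 gives c = 0. *)
Lemma residue_uniq c b : kappa c = y * b -> c = 0.
Proof.
have [q [r [q1 bq]]] := denominator_ex b => cb.
have /poly_in_inj/(congr1 (horner^~ 1)) :
    poly_in (c%:P * q) = poly_in (('X - 1%:P) * r).
  by rewrite !rmorphM /= -bq mulrA -/y -cb.
rewrite !hornerE subrr mul0r => /eqP.
by rewrite mulf_eq0 (negPf q1) orbF => /eqP.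
Qed.

Definition bounded_numerator (q : {poly F}) (n : nat) : set A :=
  [set a | exists2 r : {poly F}, (size r <= n)%N & a * poly_in q = poly_in r].

(** The step which uses that 1 is not a pole is filt_div: if y a = r / q and
    a = t / s with s(1) <> 0, then r s = (x - 1) t q, so r vanishes at 1 and
    a = (r / (x - 1)) / q. *)
Lemma bounded_numerator_filtration q :
  q != 0 -> degree_filtration kappa y (bounded_numerator q).
Proof.
move=> q0; have q_reg := poly_in_lreg q0; split.
- move=> n; pose f (v : 'rV[F]_n) : A := insubd 0 ((rVpoly v)%:F / q%:F).
  apply: (sub_finite_set _ (finite_image f (@finite_finset _ setT))).
  move=> a [r rn ar]; exists (poly_rV r) => //.
  rewrite /f poly_rV_K //; apply: (can_inj (valKd 0)).
  have -> : r%:F / q%:F = val a.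
    by rewrite -val_poly_in -ar rmorphM /= mulfK // tofrac_eq0.
  by rewrite valKd.
- move=> a [r]; rewrite leqn0 size_poly_eq0 => /eqP-> ar.
  by apply: q_reg; rewrite mulrC ar rmorph0 mulr0.
- by move=> n; exists 0; rewrite ?size_poly0 // rmorph0 mul0r.
- move=> n a b [r rn ar] [r' rn' br']; exists (r - r').
    by rewrite (leq_trans (size_polyD _ _)) // size_polyN geq_max rn.
  by rewrite rmorphB mulrBl ar br'.
- move=> n c a [r rn ar]; exists (c *: r).
    exact: leq_trans (size_scale_leq _ _) rn.
  by rewrite -mul_polyC rmorphM /= -mulrA ar.
- by move=> n a [r rn ar]; exists r => //; apply: leqW.
- move=> n a [r rn ar]; exists (('X - 1%:P) * r).
    rewrite mulrC; have [->|r0] := eqVneq r 0.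
      by rewrite mul0r size_poly0.
    by rewrite size_Mmonic ?monicXsubC // size_XsubC addn2.
  by rewrite rmorphM /= -mulrA ar.
move=> n a [r rn yar]; have [s [t [s1 as_t]]] := denominator_ex a.
have E : r * s = ('X - 1%:P) * t * q.
  by apply: poly_in_inj; rewrite !rmorphM /= -yar -as_t -/y; ring.
have /factor_theorem[g rE] : root r 1.
  have /(congr1 (horner^~ 1)) := E; rewrite !hornerE subrr !mul0r => /eqP.
  by rewrite mulf_eq0 (negPf s1) orbF rootE.
exists g.
  move: rn; rewrite rE; have [->|g0] := eqVneq g 0; first by rewrite size_poly0.
  by rewrite size_Mmonic ?monicXsubC // size_XsubC addn2.
apply: y_lreg; rewrite mulrA yar rE rmorphM /= mulrC //.
Qed.

Lemma filtration_ex (s : seq A) : exists W n,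
  degree_filtration kappa y W /\ {in s, forall a, W n a}.
Proof.
have [q q0 sq] := common_denominator_ex s.
have WP := bounded_numerator_filtration q0.
exists (bounded_numerator q).
elim: s sq => [|a s IH] sq; first by exists 0%N.
have [n [_ sn]] := IH (fun b bs => sq b (mem_behead (s := a :: s) bs)).
have [r ar] := sq a (mem_head a s).
exists (maxn n (size r)); split=> // b; rewrite in_cons => /predU1P[->|/sn Wb].
  by exists r => //; apply: leq_maxr.
exact: (filt_le WP) (leq_maxl _ _) Wb.
Qed.

Lemma gen_subring_pborel_self_similar (m : nat) :
  transitive_finite_state_state_closed #|digit_array F m| (pborel m A).
Proof.
exact: (pborel_self_similar y_lreg residue_ex residue_uniq filtration_ex).
Qed.

End LocalisedPolynomialRing.

(** * The degree of the tree *)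

Lemma sum_descent (m : nat) : (2 * \sum_(i < m) (m - i) = m ^ 2 + m)%N.
Proof.
elim: m => [|m IH]; first by rewrite big_ord0.
rewrite big_ord_recl mulnDr.
under eq_bigr do rewrite lift0 subSS.
by rewrite IH subn0 expnS expn1; lia.
Qed.

(** The left-hand sum counts the digits of a digit array; the index of the
    domain of the dilation is #|F| to that power. *)
Lemma sum_gaps (m : nat) :
  (6 * \sum_(i < m) \sum_(j < m) (j - i) + m = m ^ 3)%N.
Proof.
elim: m => [|m IH]; first by rewrite big_ord0.
rewrite big_ord_recr /=.
have -> : (\sum_(j < m.+1) (j - m) = 0)%N.
  by apply: big1 => j _; apply/eqP; rewrite subn_eq0 -ltnS.
rewrite addn0.
under eq_bigr do rewrite big_ord_recr /=.
rewrite big_split /= mulnDr.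
have := sum_descent m; move: IH; rewrite !expnS expn0 !muln1.
by move: (\sum_(i < m) _)%N (\sum_(i < m) _)%N => a b; lia.
Qed.

Lemma card_digit_array (F : finFieldType) (m : nat) :
  #|digit_array F m| = (#|F| ^ \sum_(i < m) \sum_(j < m) (j - i))%N.
Proof.
rewrite card_dep_ffun foldrE big_map big_enum /=.
under eq_bigr do rewrite card_ffun card_ord.
by rewrite -expn_sum pair_bigA.
Qed.

Lemma size_gap_poly : size (6%:R^-1 *: ('X^3 - 'X) : {poly rat}) = 4%N.
Proof.
by rewrite size_scale // size_polyDl ?size_polyXn // size_polyN size_polyX.
Qed.

Lemma gap_polyE (m : nat) : (6%:R^-1 *: ('X^3 - 'X) : {poly rat}).[m%:R] =
  (\sum_(i < m) \sum_(j < m) (j - i))%N%:R.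
Proof.
rewrite !hornerE -natrX -[in LHS](sum_gaps m) natrD addrK natrM.
by rewrite mulKf.
Qed.

(** A monic irreducible polynomial with root 1 is x - 1 itself. *)
Lemma irreducible_not_root1 (F : fieldType) (q : {poly F}) :
  q \is monic -> irreducible_poly q ->
  ~ (exists c : F, q = c *: ('X - 1)) -> q.[1] != 0.
Proof.
move=> q_monic [_ q_irr] q_neq; apply/negP => q1; apply: q_neq; exists 1.
have : 'X - 1%:P %= q by apply: q_irr; rewrite ?size_XsubC // dvdp_XsubCl.
by rewrite eqp_monic ?monicXsubC // scale1r => /eqP <-.
Qed.

Theorem theoremA :
  exists l : {poly rat}, size l = 4%N /\
    forall (n m p : nat) (f : 'I_n -> {poly 'F_p}),
      (1 <= n)%N -> (1 <= m)%N -> prime p ->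
      (forall i : 'I_n, i = 0%N :> nat -> f i = 'X) ->
      injective f ->
      (forall i, f i \is monic) ->
      (forall i, irreducible_poly (f i)) ->
      (forall i, ~ exists c : 'F_p, f i = c *: ('X - 1)) ->
      exists2 d : nat, l.[m%:R] = d%:R
        & transitive_finite_state_state_closed (p ^ d) (pborel m (laurent_ring f)).
Proof.
exists (6%:R^-1 *: ('X^3 - 'X)); split; first exact: size_gap_poly.
move=> n m p f _ _ p_prime _ _ f_monic f_irr f_neq.
exists (\sum_(i < m) \sum_(j < m) (j - i))%N; first exact: gap_polyE.
rewrite -[X in (X ^ _)%N](card_Fp p_prime) -card_digit_array.
apply: gen_subring_pborel_self_similar => [c||z].
- by left; left; exists c.
- by left; right; left.
case=> [[[c _ <-]|[->|->]]|[i _ <-]].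
- by left; exists c%:P.
- by left; exists 'X.
- by right; exists 'X; rewrite // hornerX oner_neq0.
by right; exists (f i) => //; apply: irreducible_not_root1.
Qed.
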